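(* Let $m,n\ge2$. Every symmetric $B_0$-biquadratic tensor in $\mathbb{R}^{m\times n\times m\times n}$ is positive semi-definite, and every symmetric $B$-biquadratic tensor in $\mathbb{R}^{m\times n\times m\times n}$ is positive definite.
   Context: Write $[n]=\{1,\dots,n\}$. A biquadratic tensor is a real fourth-order tensor $\mathcal{A}=(a_{i_1j_1i_2j_2})\in\mathbb{R}^{m\times n\times m\times n}$, $i_1,i_2\in[m]$, $j_1,j_2\in[n]$, $m,n\ge2$. It is symmetric if for all $i_1,i_2\in[m]$, $j_1,j_2\in[n]$: $a_{i_1j_1i_2j_2}=a_{i_2j_2i_1j_1}$ and $a_{i_1j_1i_2j_2}=a_{i_2j_1i_1j_2}=a_{i_1j_2i_2j_1}$. Entries $a_{ijij}$ are diagonal, all others off-diagonal; $\bar a_{i_1j_1i_2j_2}=a_{i_1j_1i_2j_2}$ for off-diagonal entries and $\bar a_{i_1j_1i_2j_2}=0$ for diagonal ones. For $i\in[m]$, $j\in[n]$ let $$S_{ij}=\sum_{i_1=1}^m\Big(\sum_{j_2=1}^n a_{i_1jij_2}+\sum_{j_1=1}^n a_{i_1j_1ij}\Big)+\sum_{i_2=1}^m\Big(\sum_{j_2=1}^n a_{iji_2j_2}+\sum_{j_1=1}^n a_{ij_1i_2j}\Big).$$ $\mathcal{A}$ is a $B_0$-biquadratic tensor if $S_{ij}\ge0$ for all $i\in[m],j\in[n]$, and $$\frac{1}{4mn}S_{ij}\ge\max\{\bar a_{iji_2j_2},\bar a_{i_1jij_2},\bar a_{ij_1i_2j},\bar a_{i_1j_1ij}\}$$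 for all $i,i_1,i_2\in[m]$, $j,j_1,j_2\in[n]$. It is a $B$-biquadratic tensor if all these inequalities are strict. Put $f(\mathbf{x},\mathbf{y})=\sum_{i_1,i_2=1}^m\sum_{j_1,j_2=1}^n a_{i_1j_1i_2j_2}x_{i_1}y_{j_1}x_{i_2}y_{j_2}$. $\mathcal{A}$ is positive semi-definite if $f(\mathbf{x},\mathbf{y})\ge0$ for all $\mathbf{x}\in\mathbb{R}^m,\mathbf{y}\in\mathbb{R}^n$, and positive definite if $f(\mathbf{x},\mathbf{y})>0$ whenever $\mathbf{x}^\top\mathbf{x}=\mathbf{y}^\top\mathbf{y}=1$. *)

(* Defs.v *)
From mathcomp Require Import all_boot all_order all_algebra.
From mathcomp Require Import reals.

Set Implicit Arguments.
Unset Strict Implicit.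
Unset Printing Implicit Defensive.

Import Order.TTheory GRing.Theory Num.Theory.
Local Open Scope ring_scope.

(* The entry a_{i1 j1 i2 j2} of A is [A i1 j1 i2 j2]: the arguments come in
   the order of the modes of R^(m x n x m x n). *)
Definition biquadratic_tensor (R : realType) (m n : nat) : Type :=
  'I_m -> 'I_n -> 'I_m -> 'I_n -> R.

Definition symmetric_tensor (R : realType) (m n : nat)
    (A : biquadratic_tensor R m n) : Prop :=
  forall (i1 i2 : 'I_m) (j1 j2 : 'I_n),
    [/\ A i1 j1 i2 j2 = A i2 j2 i1 j1,
        A i1 j1 i2 j2 = A i2 j1 i1 j2
      & A i1 j1 i2 j2 = A i1 j2 i2 j1].

Definition offdiag (R : realType) (m n : nat)
    (A : biquadratic_tensor R m n) : biquadratic_tensor R m n :=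
  fun i1 j1 i2 j2 => if (i1 == i2) && (j1 == j2) then 0 else A i1 j1 i2 j2.

Definition slice_sum (R : realType) (m n : nat)
    (A : biquadratic_tensor R m n) (i : 'I_m) (j : 'I_n) : R :=
  \sum_(i1 < m) (\sum_(j2 < n) A i1 j i j2 + \sum_(j1 < n) A i1 j1 i j)
  + \sum_(i2 < m) (\sum_(j2 < n) A i j i2 j2 + \sum_(j1 < n) A i j1 i2 j).

Definition offdiag_max (R : realType) (m n : nat)
    (A : biquadratic_tensor R m n) (i i1 i2 : 'I_m) (j j1 j2 : 'I_n) : R :=
  Num.max (offdiag A i j i2 j2)
    (Num.max (offdiag A i1 j i j2)
      (Num.max (offdiag A i j1 i2 j) (offdiag A i1 j1 i j))).

Definition B0_tensor (R : realType) (m n : nat)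
    (A : biquadratic_tensor R m n) : Prop :=
  (forall (i : 'I_m) (j : 'I_n), 0 <= slice_sum A i j) /\
  (forall (i i1 i2 : 'I_m) (j j1 j2 : 'I_n),
     offdiag_max A i i1 i2 j j1 j2 <= (4 * m * n)%:R^-1 * slice_sum A i j).

Definition B_tensor (R : realType) (m n : nat)
    (A : biquadratic_tensor R m n) : Prop :=
  (forall (i : 'I_m) (j : 'I_n), 0 < slice_sum A i j) /\
  (forall (i i1 i2 : 'I_m) (j j1 j2 : 'I_n),
     offdiag_max A i i1 i2 j j1 j2 < (4 * m * n)%:R^-1 * slice_sum A i j).

Definition biquadratic_form (R : realType) (m n : nat)
    (A : biquadratic_tensor R m n) (x : 'cV[R]_m) (y : 'cV[R]_n) : R :=
  \sum_(i1 < m) \sum_(i2 < m) \sum_(j1 < n) \sum_(j2 < n)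
     A i1 j1 i2 j2 * x i1 0 * y j1 0 * x i2 0 * y j2 0.

Definition positive_semidefinite (R : realType) (m n : nat)
    (A : biquadratic_tensor R m n) : Prop :=
  forall (x : 'cV[R]_m) (y : 'cV[R]_n), 0 <= biquadratic_form A x y.

Definition positive_definite (R : realType) (m n : nat)
    (A : biquadratic_tensor R m n) : Prop :=
  forall (x : 'cV[R]_m) (y : 'cV[R]_n),
    x^T *m x = 1%:M -> y^T *m y = 1%:M -> 0 < biquadratic_form A x y.

(* Main.v *)
Require Import Defs.
From mathcomp Require Import all_boot all_order all_algebra.
From mathcomp Require Import reals.
From mathcomp Require Import ring.

(** Symmetry of [A] gives [slice_sum A i j = 4 * \sum_(k, l) A i j k l], so the
    matrix [M], indexed by pairs [p = (i, j)], with entries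
    [M p q = A p.1 p.2 q.1 q.2] is a symmetric B0-matrix (resp. B-matrix): its
    row sums [r p] are nonnegative and every off-diagonal entry is at most the
    mean of its row.  Moreover the biquadratic form of [A] at [(x, y)] is the
    quadratic form of [M] at the vector [z (i, j) = x i * y j], so it is enough
    to bound the quadratic form of [M] from below.

    Let [N] be the order of [M] and let [b p] be the maximum of 0 and of the
    off-diagonal entries of row [p], so that [N * b p <= r p].  Write [M = K + C]
    with [K p q = min (b p) (b q)].  The kernel [K] is positive semi-definite,
    being a nonnegative combination of the all-ones blocks on the level sets of
    [b] ([min_kernel_psd]).  By symmetry of [M] the off-diagonal entries of [C]
    are nonpositive, so its quadratic form is at least the one of the diagonal
    matrix of its row sums ([quadratic_form_ge_row_sums]), and these are at
    least [r p - N * b p].  Hence [z^T M z] is at least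
    [\sum_p (r p - N * b p) * z p ^+ 2] ([quadratic_form_ge_row_excess]).  All
    coefficients are nonnegative in the B0 case and positive in the B case. *)

Set Implicit Arguments.
Unset Strict Implicit.
Unset Printing Implicit Defensive.

Import Order.TTheory GRing.Theory Num.Theory.
Local Open Scope ring_scope.

(** The kernel [min (b p) (b q)] is positive semi-definite.  The induction is on
    the size of the support [S] of [b]: if [mu] is the least positive value of
    [b], subtracting [mu] from [b] on [S] removes [mu * (\sum_(p in S) z p) ^+ 2]
    from the form and shrinks the support. *)
Lemma min_kernel_psd (R : realDomainType) (T : finType) (b z : T -> R) :
  (forall p, 0 <= b p) ->
  0 <= \sum_p \sum_q Num.min (b p) (b q) * (z p * z q).
Proof.
have [k le_k] := ubnP #|[pred p | 0 < b p]|.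
elim: k b le_k => // k IHk b le_k b_ge0.
have b0 p : ~~ (0 < b p) -> b p = 0.
  by rewrite -leNgt => bp; apply/eqP; rewrite eq_le b_ge0 andbT.
have [p0 p0_gt0|b_le0] := pickP [pred p | 0 < b p]; last first.
  rewrite big1 // => p _; rewrite big1 // => q _.
  have /negbT/b0 -> := b_le0 p; have /negbT/b0 -> := b_le0 q.
  by rewrite minxx mul0r.
have [pm pm_gt0 pm_min] := arg_minP b p0_gt0.
pose mu := b pm; pose ind p : R := (0 < b p)%R%:R.
pose b' p := b p - mu * ind p.
have mu_gt0 : 0 < mu by [].
have b'_ge0 p : 0 <= b' p.
  rewrite /b' /ind; case: (boolP (0 < b p)) => [bp|/b0 ->].
    by rewrite mulr1 subr_ge0; apply: pm_min.
  by rewrite mulr0 subr0.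
have b'_lt : (#|[pred p | (0 < b' p)%R]| < k)%N.
  apply: leq_trans (proper_card _) le_k; apply/properP; split.
    apply/subsetP => p; rewrite !inE => /lt_le_trans; apply.
    by rewrite /b' gerBl mulr_ge0 ?ler0n // ltW.
  exists pm; rewrite !inE //.
  by rewrite /b' /ind (pm_gt0 : 0 < b pm) mulr1 subrr ltxx.
have minE p q : Num.min (b p) (b q)
    = Num.min (b' p) (b' q) + mu * (ind p * ind q).
  move: (b'_ge0 p) (b'_ge0 q); rewrite /b' /ind.
  case: (boolP (0 < b p)) => [bp|/b0 ->]; case: (boolP (0 < b q)) => [bq|/b0 ->];
    rewrite ?mulr1 ?mulr0 ?mul0r ?subr0 ?addr0 // => hp hq.
  - by rewrite addr_minl !subrK.
  - by rewrite !min_r // ltW.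
  - by rewrite !min_l // ltW.
suff -> : \sum_p \sum_q Num.min (b p) (b q) * (z p * z q)
    = \sum_p \sum_q Num.min (b' p) (b' q) * (z p * z q)
      + mu * (\sum_p ind p * z p) ^+ 2.
  by rewrite addr_ge0 ?IHk // mulr_ge0 ?sqr_ge0 // ltW.
rewrite expr2 big_distrl /= mulr_sumr -big_split /=; apply: eq_bigr => p _.
rewrite !mulr_sumr -big_split /=; apply: eq_bigr => q _.
by rewrite minE; ring.
Qed.

(** A symmetric matrix with nonpositive off-diagonal entries dominates the
    diagonal matrix of its row sums: the difference of the two forms is
    [- (\sum_p \sum_q c p q * (z p - z q) ^+ 2) / 2]. *)
Lemma quadratic_form_ge_row_sums (R : realDomainType) (T : finType)
    (c : T -> T -> R) (z : T -> R) :
  (forall p q, c p q = c q p) -> (forall p q, p != q -> c p q <= 0) ->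
  \sum_p (\sum_q c p q) * z p ^+ 2 <= \sum_p \sum_q c p q * (z p * z q).
Proof.
move=> c_sym c_le0; rewrite -subr_ge0 -(pmulr_rge0 _ (ltr0n R 2)).
have rowE : \sum_p (\sum_q c p q) * z p ^+ 2
    = \sum_p \sum_q c p q * z p ^+ 2.
  by apply: eq_bigr => p _; rewrite mulr_suml.
have colE : \sum_p (\sum_q c p q) * z p ^+ 2
    = \sum_p \sum_q c p q * z q ^+ 2.
  rewrite rowE exchange_big /=; apply: eq_bigr => p _.
  by apply: eq_bigr => q _; rewrite c_sym.
suff -> : 2 * (\sum_p \sum_q c p q * (z p * z q)
               - \sum_p (\sum_q c p q) * z p ^+ 2)
    = \sum_p \sum_q (- c p q * (z p - z q) ^+ 2).
  apply: sumr_ge0 => p _; apply: sumr_ge0 => q _.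
  have [->|/c_le0 cpq] := eqVneq p q; first by rewrite subrr expr0n mulr0.
  by rewrite mulr_ge0 ?sqr_ge0 // oppr_ge0.
have sumE : 2 * (\sum_p (\sum_q c p q) * z p ^+ 2)
    = \sum_p \sum_q c p q * z p ^+ 2 + \sum_p \sum_q c p q * z q ^+ 2.
  by rewrite -rowE -colE; ring.
rewrite mulrBr sumE mulr_sumr -big_split -sumrB /=; apply: eq_bigr => p _.
rewrite mulr_sumr -big_split -sumrB /=; apply: eq_bigr => q _.
by ring.
Qed.

(** If [b p >= 0] bounds the off-diagonal entries of row [p] of a symmetric
    matrix, its quadratic form dominates the diagonal form whose coefficients
    are the excesses of the row sums over [#|T| * b p]. *)
Lemma quadratic_form_ge_row_excess (R : realDomainType) (T : finType)
    (M : T -> T -> R) (b z : T -> R) :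
  (forall p q, M p q = M q p) -> (forall p, 0 <= b p) ->
  (forall p q, p != q -> M p q <= b p) ->
  \sum_p (\sum_q M p q - #|T|%:R * b p) * z p ^+ 2
    <= \sum_p \sum_q M p q * (z p * z q).
Proof.
move=> M_sym b_ge0 M_le.
pose c p q := M p q - Num.min (b p) (b q).
have c_sym p q : c p q = c q p by rewrite /c M_sym minC.
have c_le0 p q : p != q -> c p q <= 0.
  by move=> npq; rewrite /c subr_le0 le_min M_le // M_sym M_le // eq_sym.
have -> : \sum_p \sum_q M p q * (z p * z q)
    = \sum_p \sum_q c p q * (z p * z q)
      + \sum_p \sum_q Num.min (b p) (b q) * (z p * z q).
  rewrite -big_split; apply: eq_bigr => p _; rewrite -big_split.
  by apply: eq_bigr => q _; rewrite /= -mulrDl subrK.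
rewrite -[leLHS]addr0 lerD ?min_kernel_psd //.
apply: le_trans (quadratic_form_ge_row_sums z c_sym c_le0).
apply: ler_sum => p _; rewrite ler_wpM2r ?sqr_ge0 // sumrB lerB //.
rewrite mulr_natl -sumr_const; apply: ler_sum => q _.
by rewrite ge_min lexx.
Qed.

Section Unfolding.
Variables (R : realType) (m n : nat) (A : biquadratic_tensor R m n).

(** The unfolding of [A]: the square matrix whose rows and columns are indexed
    by the pairs [(i, j)]. *)
Definition unfolding (p q : 'I_m * 'I_n) : R := A p.1 p.2 q.1 q.2.

(** The maximum of 0 and of the off-diagonal entries of row [p] of the
    unfolding; a diagonal entry contributes 0. *)
Definition row_max (p : 'I_m * 'I_n) : R :=
  \big[Num.max/0]_q offdiag A p.1 p.2 q.1 q.2.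

Lemma row_max_ge0 p : 0 <= row_max p.
Proof. exact: bigmax_ge_id. Qed.

Lemma unfolding_le_row_max p q : p != q -> unfolding p q <= row_max p.
Proof.
move=> npq; have -> : unfolding p q = offdiag A p.1 p.2 q.1 q.2.
  by rewrite /offdiag -xpair_eqE -!surjective_pairing (negPf npq).
exact: (le_bigmax _ (fun r => offdiag A p.1 p.2 r.1 r.2)).
Qed.

Lemma offdiag_le_max (i i1 i2 : 'I_m) (j j1 j2 : 'I_n) :
  offdiag A i j i2 j2 <= offdiag_max A i i1 i2 j j1 j2.
Proof. by rewrite /offdiag_max le_max lexx. Qed.

Lemma biquadratic_form_unfolding (x : 'cV[R]_m) (y : 'cV[R]_n) :
  biquadratic_form A x y
  = \sum_p \sum_q unfolding p q * (x p.1 0 * y p.2 0 * (x q.1 0 * y q.2 0)).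
Proof.
rewrite /biquadratic_form.
under eq_bigr do rewrite exchange_big.
rewrite pair_big /=; apply: eq_bigr => p _.
by rewrite pair_big /=; apply: eq_bigr => q _; rewrite /unfolding; ring.
Qed.

Hypothesis A_sym : symmetric_tensor A.

Lemma unfolding_sym p q : unfolding p q = unfolding q p.
Proof. by rewrite /unfolding; have [] := A_sym p.1 q.1 p.2 q.2. Qed.

(** The four double sums in [slice_sum A i j] agree. *)
Lemma slice_sum_unfolding p :
  slice_sum A p.1 p.2 = 4 * \sum_q unfolding p q.
Proof.
have -> : \sum_q unfolding p q = \sum_k \sum_l A p.1 p.2 k l.
  by rewrite pair_big.
rewrite /slice_sum !big_split /=.
have -> : \sum_k \sum_l A k p.2 p.1 l = \sum_k \sum_l A p.1 p.2 k l.
  by apply: eq_bigr => k _; apply: eq_bigr => l _; have [] := A_sym k p.1 p.2 l.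
have -> : \sum_k \sum_l A k l p.1 p.2 = \sum_k \sum_l A p.1 p.2 k l.
  by apply: eq_bigr => k _; apply: eq_bigr => l _; have [] := A_sym k p.1 l p.2.
have -> : \sum_k \sum_l A p.1 l k p.2 = \sum_k \sum_l A p.1 p.2 k l.
  by apply: eq_bigr => k _; apply: eq_bigr => l _; have [] := A_sym p.1 k l p.2.
by ring.
Qed.

Lemma mean_slice_sum p :
  (4 * m * n)%:R^-1 * slice_sum A p.1 p.2
  = #|{: 'I_m * 'I_n}|%:R^-1 * \sum_q unfolding p q.
Proof.
rewrite slice_sum_unfolding card_prod !card_ord -mulnA natrM invfM.
by rewrite mulrACA mulVf ?pnatr_eq0 // mul1r.
Qed.

Lemma card_pairs_gt0 (p : 'I_m * 'I_n) : 0 < #|{: 'I_m * 'I_n}|%:R :> R.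
Proof. by rewrite ltr0n; apply/card_gt0P; exists p. Qed.

Lemma B0_row_excess_ge0 p : B0_tensor A ->
  0 <= \sum_q unfolding p q - #|{: 'I_m * 'I_n}|%:R * row_max p.
Proof.
move=> [S_ge0 max_le]; have N_gt0 := card_pairs_gt0 p.
rewrite subr_ge0 -ler_pdivlMl // -mean_slice_sum; apply: bigmax_le => [|q _].
  by rewrite mulr_ge0 ?invr_ge0 ?ler0n.
exact: le_trans (offdiag_le_max _ p.1 _ _ p.2 _) (max_le _ _ _ _ _ _).
Qed.

Lemma B_row_excess_gt0 p : B_tensor A ->
  0 < \sum_q unfolding p q - #|{: 'I_m * 'I_n}|%:R * row_max p.
Proof.
move=> [S_gt0 max_lt]; have N_gt0 := card_pairs_gt0 p.
rewrite subr_gt0 -ltr_pdivlMl // -mean_slice_sum; apply: bigmax_lt => [|q _].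
  rewrite mean_slice_sum mulr_gt0 ?invr_gt0 //.
  by have := S_gt0 p.1 p.2; rewrite slice_sum_unfolding pmulr_rgt0.
exact: le_lt_trans (offdiag_le_max _ p.1 _ _ p.2 _) (max_lt _ _ _ _ _ _).
Qed.

Lemma biquadratic_form_ge_row_excess (x : 'cV[R]_m) (y : 'cV[R]_n) :
  \sum_p (\sum_q unfolding p q - #|{: 'I_m * 'I_n}|%:R * row_max p)
         * (x p.1 0 * y p.2 0) ^+ 2
    <= biquadratic_form A x y.
Proof.
rewrite biquadratic_form_unfolding.
exact: (quadratic_form_ge_row_excess (fun p => x p.1 0 * y p.2 0)
  unfolding_sym row_max_ge0 unfolding_le_row_max).
Qed.

End Unfolding.

Lemma unit_vector_coord_neq0 (R : nzRingType) (k : nat) (v : 'cV[R]_k) :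
  v^T *m v = 1%:M -> exists i, v i 0 != 0.
Proof.
move=> v1; apply/existsP; apply: contraT; rewrite negb_exists => /forallP v0.
move/matrixP/(_ 0 0): v1; rewrite !mxE big1 => [/eqP|i _].
  by rewrite eqxx eq_sym oner_eq0.
by have /negPn/eqP vi := v0 i; rewrite vi mulr0.
Qed.

Theorem corollary5p6 (R : realType) (m n : nat)
    (hm : (2 <= m)%N) (hn : (2 <= n)%N) :
  (forall A : biquadratic_tensor R m n,
     symmetric_tensor A -> B0_tensor A -> positive_semidefinite A) /\
  (forall A : biquadratic_tensor R m n,
     symmetric_tensor A -> B_tensor A -> positive_definite A).
Proof.
split=> A A_sym hA x y.
  apply: le_trans (biquadratic_form_ge_row_excess A_sym x y).
  by apply: sumr_ge0 => p _; rewrite mulr_ge0 ?sqr_ge0 ?B0_row_excess_ge0.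
move=> /unit_vector_coord_neq0[i xi] /unit_vector_coord_neq0[j yj].
apply: lt_le_trans (biquadratic_form_ge_row_excess A_sym x y).
have term_ge0 p : 0 <= (\sum_q unfolding A p q
    - #|{: 'I_m * 'I_n}|%:R * row_max A p) * (x p.1 0 * y p.2 0) ^+ 2.
  by rewrite mulr_ge0 ?sqr_ge0 // ltW // B_row_excess_gt0.
rewrite (bigD1 (i, j)) //= ltr_pwDl ?sumr_ge0 //.
by rewrite mulr_gt0 ?B_row_excess_gt0 // exprn_even_gt0 // mulf_neq0.
Qed.
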